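(* Let $\mathcal H$ be an infinite-dimensional separable complex Hilbert space, and let $p,q\in[1,\infty]$ be conjugate, i.e. $\frac1p+\frac1q=1$. Let $C\in\mathcal B^p(\mathcal H)$ and $T\in\mathcal B^q(\mathcal H)$. Then the closure $\overline{W_C(T)}\subseteq\mathbb C$ of the $C$-numerical range of $T$ is star-shaped with respect to the origin.
   Context: Notation: $\mathcal B(\mathcal H)$ denotes the bounded linear operators on $\mathcal H$, and $U^\dagger$ denotes the Hilbert space adjoint of $U$. Every compact operator $C$ on $\mathcal H$ has a Schmidt decomposition $C=\sum_{n=1}^\infty s_n(C)\langle f_n,\cdot\rangle g_n$ with orthonormal systems $(f_n)_{n\in\mathbb N}$, $(g_n)_{n\in\mathbb N}$ and a decreasing null sequence $(s_n(C))_{n\in\mathbb N}$ in $[0,\infty)$ of singular numbers, which is uniquely determined by $C$. For $p\in[1,\infty)$, $\mathcal B^p(\mathcal H)$ is the Schatten class of all compact operators $C$ on $\mathcal H$ with $\sum_{n=1}^\infty s_n(C)^p<\infty$; $\mathcal B^\infty(\mathcal H)$ is the set of all compact operators on $\mathcal H$. Conjugacy uses the convention $1/\infty=0$, so $1$ and $\infty$ are conjugate. For $C\in\mathcal B^p(\mathcal H)$ and $T\in\mathcal B^q(\mathcal H)$ with $p,q$ conjugate, the $C$-numerical range of $T$ is $$W_C(T):=\{\operatorname{tr}(CU^\dagger TU)\mid U\in\mathcal B(\mathcal H)\text{ unitary}\},$$ where the trace is well-defined since $CU^\dagger TU$ is trace class. A set $S\subseteq\mathbb C$ is star-shaped with respect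 to $z_0\in S$ if $(1-t)z_0+tz\in S$ for all $z\in S$ and $t\in[0,1]$. *)

(* Defs.v *)
From mathcomp Require Import all_boot all_order all_algebra sesquilinear.
From mathcomp Require Import complex.
From mathcomp Require Import all_classical all_reals all_analysis.

Set Implicit Arguments.
Unset Strict Implicit.
Unset Printing Implicit Defensive.

Import Order.TTheory GRing.Theory Num.Theory.
Import numFieldNormedType.Exports.

Local Open Scope classical_set_scope.
Local Open Scope ring_scope.
Local Open Scope complex_scope.

(* The complex numbers are R[i] for a realType R; topological statements about
   them go through the regular module R[i]^o.

   A complex Hilbert space is a complete normed module H over R[i] with a
   positive definite Hermitian form dot inducing its norm (hilbert_norm).
   MathComp forms are linear in the FIRST argument, so the physicists'
   <f, x> (linear in x) is written dot x f. *)

Section Hilbert.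
Variables (R : realType) (H : completeNormedModType R[i]).
Variable dot : {dot H for (@Num.conj R[i])}.

Definition hilbert_norm : Prop := forall x : H, dot x x = `|x| ^+ 2.

Definition infinite_dimensional : Prop :=
  ~ exists (n : nat) (v : 'I_n -> H),
      forall x : H, exists a : 'I_n -> R[i], x = \sum_(i < n) a i *: v i.

Definition separable : Prop := exists2 D : set H, countable D & dense D.

Definition orthonormal_seq (e : nat -> H) : Prop :=
  forall m n : nat, dot (e m) (e n) = (m == n)%:R.

Definition orthonormal_basis (e : nat -> H) : Prop :=
  orthonormal_seq e /\
  forall x : H, series (fun n => dot x (e n) *: e n) @ \oo --> x.

Definition bounded_op (A : {linear H -> H}) : Prop := bounded_near A (nbhs 0).

Definition compact_op (A : {linear H -> H}) : Prop :=
  precompact (A @` [set x : H | `|x| <= 1]).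

Definition schmidt_decomposition (A : {linear H -> H})
    (s : nat -> R) (f g : nat -> H) : Prop :=
  [/\ orthonormal_seq f, orthonormal_seq g
    & forall x : H,
        series (fun n => ((s n)%:C * dot x (f n)) *: g n) @ \oo --> A x].

(* s is the sequence (s_n(A)) of singular numbers; it is unique. *)
Definition singular_numbers (A : {linear H -> H}) (s : nat -> R) : Prop :=
  [/\ forall n, 0 <= s n,
      nonincreasing_seq s,
      s @ \oo --> (0 : R)
    & exists f g : nat -> H, schmidt_decomposition A s f g].

(* Only meaningful for 1 <= p; schatten +oo is the set of compact operators. *)
Definition schatten (p : \bar R) (A : {linear H -> H}) : Prop :=
  compact_op A /\
  forall r : R, p = r%:E ->
    exists2 s, singular_numbers A s
             & (\sum_(0 <= n <oo) (s n `^ r)%:E < +oo)%E.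

Definition adjoint (A : H -> H) (y : H) : H :=
  xget 0 [set z : H | forall x : H, dot (A x) y = dot x z].

Definition unitary (U : {linear H -> H}) : Prop :=
  [/\ bounded_op U, adjoint U \o U =1 id & U \o adjoint U =1 id].

(* The basis-independent value of sum_n <e_n, A e_n>, as for trace class A. *)
Definition has_trace (A : H -> H) (z : R[i]^o) : Prop :=
  forall e : nat -> H, orthonormal_basis e ->
    series (fun n => dot (A (e n)) (e n) : R[i]^o) @ \oo --> z.

Definition trace (A : H -> H) : R[i]^o := xget 0 (has_trace A).

Definition C_numerical_range (C T : {linear H -> H}) : set R[i]^o :=
  [set z | exists2 U : {linear H -> H},
             unitary U & z = trace (C \o adjoint U \o T \o U)].

End Hilbert.

Definition star_shaped (R : realType) (S : set R[i]^o) (z0 : R[i]^o) : Prop :=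
  S z0 /\ forall (z : R[i]^o) (t : R), S z -> 0 <= t <= 1 ->
            S ((1 - t)%:C * z0 + t%:C * z).

(* Main.v *)
Require Import Defs.
From HB Require Import structures.
From mathcomp Require Import all_boot all_order all_algebra sesquilinear.
From mathcomp Require Import complex ring lra.
From mathcomp Require Import all_classical all_reals all_analysis.

Set Implicit Arguments.
Unset Strict Implicit.
Unset Printing Implicit Defensive.

Import Order.TTheory GRing.Theory Num.Theory.
Import numFieldNormedType.Exports.

Local Open Scope classical_set_scope.
Local Open Scope ring_scope.
Local Open Scope complex_scope.

(** Why the theorem holds.  Let U be unitary and 0 <= t <= 1; the point
    t tr(C U^* T U) has to be approximated by points of the C-numerical range.
    Fix an orthonormal basis (e_k) and put c = sqrt t, s = sqrt (1 - t).  Let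
    V_N be the unitary that rotates each plane spanned by e_k and e_(N+k),
    k < N, by the angle with cosine c and sine s.  For large N it sends e_k to
    c e_k + s e_(N+k), and the second term goes weakly to 0, so V_N -> c id and
    V_N^* -> c id weakly ([rotation_wcvg]): infinite dimension leaves room to
    hide the missing mass at infinity.  Hence one expects
    tr(C (V_N U)^* T (V_N U)) -> c^2 tr(C U^* T U) = t tr(C U^* T U), and this
    gives the theorem.

    What remains is that the map (Y, Z) |-> tr(C Y T Z), for contractions Y
    and Z, is well defined and continuous for weak convergence.  If C has the
    Schmidt decomposition sum_n s_n <f_n, .> g_n, the candidate is the series
    sum_n s_n <f_n, Y T Z g_n>.  Each term is weakly continuous because T is
    compact, hence turns weak into norm convergence ([compact_op_wcvg]).  The
    tails of the series are small uniformly in Y and Z: for p = 1 because T is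
    bounded ([uniform_tails_l1]), and for conjugate exponents in (1, oo) by a
    form of Hoelder's inequality, proved from Young's inequality and the Schur
    test with the weights given by Bessel's inequality
    ([uniform_tails_conjugate]).  Therefore the series is weakly continuous
    ([trace_form_continuous]).

    The same continuity shows that the series is the trace along every
    orthonormal basis: if P_N is the projection onto the first N basis vectors,
    then the N-th partial sum of the diagonal of C Y T Z is the series for
    (Y, Z P_N), and P_N -> id.  For p = oo no Schmidt decomposition of C is
    given, but then q = 1 and the roles of C and T are exchanged, with the
    N-th partial sum being the series for (Z P_N, Y). *)

(** * Inner products and Bessel's inequality *)
Section InnerProduct.
Variables (R : realType) (H : completeNormedModType R[i]).
Variable dot : {dot H for (@Num.conj R[i])}.
Hypothesis dot_norm : hilbert_norm dot.

Implicit Types (x y : H) (a : R[i]).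

Lemma dotC x y : dot x y = Num.conj (dot y x).
Proof. by rewrite [LHS]hermC /= expr0 mul1r. Qed.

(** The sesquilinear rules are restated for the form [dot] itself, so that
    rewriting keeps both sides in terms of [dot] rather than of its underlying
    bilinear structure. *)
Lemma dotZl a x y : dot (a *: x) y = a * dot x y.
Proof. exact: linearZl_LR. Qed.

Lemma dotZr a x y : dot x (a *: y) = Num.conj a * dot x y.
Proof. exact: linearZr_LR. Qed.

Lemma dotDl x y z : dot (x + y) z = dot x z + dot y z.
Proof. exact: linearDl. Qed.

Lemma dotDr x y z : dot x (y + z) = dot x y + dot x z.
Proof. exact: linearDr. Qed.

Lemma dotBl x y z : dot (x - y) z = dot x z - dot y z.
Proof. exact: linearBl. Qed.

Lemma dotBr x y z : dot x (y - z) = dot x y - dot x z.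
Proof. exact: linearBr. Qed.

Lemma dot0l x : dot 0 x = 0.
Proof. exact: linear0l. Qed.

Lemma dot0r x : dot x 0 = 0.
Proof. exact: linear0r. Qed.

Lemma dot_suml I (r : seq I) (P : pred I) (u : I -> H) x :
  dot (\sum_(i <- r | P i) u i) x = \sum_(i <- r | P i) dot (u i) x.
Proof. exact: linear_sumlz. Qed.

Lemma dot_sumr I (r : seq I) (P : pred I) (u : I -> H) x :
  dot x (\sum_(i <- r | P i) u i) = \sum_(i <- r | P i) dot x (u i).
Proof. exact: linear_sumr. Qed.

Lemma opZ (A : {linear H -> H}) a x : A (a *: x) = a *: A x.
Proof. exact: linearZ. Qed.

Lemma norm_dotC x y : `|dot x y| = `|dot y x|.
Proof. by rewrite dotC norm_conjC. Qed.

Lemma cauchy_schwarz x y : `|dot x y| <= `|x| * `|y|.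
Proof.
have [->|y0] := eqVneq y 0; first by rewrite linear0r !normr0 mulr0.
have ny0 : 0 < `|y| by rewrite normr_gt0.
rewrite -(@ler_pXn2r _ 2)// ?nnegrE ?mulr_ge0//.
pose c := dot x y / `|y| ^+ 2.
have := dnorm_ge0 dot (x - c *: y).
rewrite dnormB /= dnormZ dotZr !dot_norm.
have n2 : `|y| ^+ 2 != 0 by rewrite expf_neq0 ?gt_eqF.
have -> : `|c| ^+ 2 * `|y| ^+ 2 = `|dot x y| ^+ 2 / `|y| ^+ 2.
  rewrite normf_div normrX normr_id expr_div_n -!exprM /= -mulrA.
  by congr (_ * _); rewrite (exprM _ 2 2) expr2 invfM mulfVK.
have -> : Num.conj c * dot x y = `|dot x y| ^+ 2 / `|y| ^+ 2.
  rewrite rmorphM fmorphV rmorphXn /= normCK (geC0_conj (normr_ge0 y)).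
  by rewrite mulrAC [_ * dot x y]mulrC.
set z := _ / _.
have zr : Num.conj z = z by rewrite geC0_conj// /z divr_ge0// exprn_ge0.
rewrite zr opprD addrA addrK subr_ge0 /z ler_pdivrMr ?exprn_gt0//.
by rewrite exprMn.
Qed.

Lemma norm_lincomb (b : nat -> H) (a : nat -> R[i]) n : orthonormal_seq dot b ->
  `|\sum_(0 <= k < n) a k *: b k| ^+ 2 = \sum_(0 <= k < n) `|a k| ^+ 2.
Proof.
move=> ob; elim: n => [|n IH]; first by rewrite !big_nil normr0 expr0n.
rewrite !big_nat_recr//= -IH -!dot_norm; set u := \sum_(_ <= _ < _) _.
have uv : dot u (b n) = 0.
  rewrite dot_suml big_nat big1// => k kn.
  by rewrite dotZl ob ltn_eqF ?mulr0.
rewrite dotDl !dotDr !dotZl !dotZr ob eqxx mulr1 -normCK.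
by rewrite uv [dot (b n) u]dotC uv conjC0 !mulr0 addr0 add0r.
Qed.

(** Bessel's inequality for the functional x |-> dot (A x) y, without reference
    to an adjoint of A: if S is the sum and v = sum_k conj (dot (A b_k) y) b_k,
    then dot (A v) y = S and |v|^2 = S, so S <= M |v| |y| = M |y| sqrt S. *)
Lemma bessel_op (b : nat -> H) (A : {linear H -> H}) (M : R[i]) y n :
  orthonormal_seq dot b -> 0 <= M -> (forall x, `|A x| <= M * `|x|) ->
  \sum_(0 <= k < n) `|dot (A (b k)) y| ^+ 2 <= (M * `|y|) ^+ 2.
Proof.
move=> ob M0 AM; set S := \sum_(_ <= _ < _) _.
have S0 : 0 <= S by apply: sumr_ge0 => k _; rewrite exprn_ge0.
pose v := \sum_(0 <= k < n) Num.conj (dot (A (b k)) y) *: b k.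
have Sv : dot (A v) y = S.
  rewrite /v linear_sum dot_suml; apply: eq_bigr => k _.
  by rewrite opZ dotZl normCKC.
have nv : `|v| ^+ 2 = S.
  by rewrite norm_lincomb//; apply: eq_bigr => k _; rewrite norm_conjC.
have [->|Sn0] := eqVneq S 0; first by rewrite exprn_ge0// mulr_ge0.
have Sgt0 : 0 < S by rewrite lt_def Sn0.
rewrite -(ler_pM2r Sgt0) -[in leRHS]nv -expr2 -exprMn.
rewrite ler_pXn2r ?nnegrE ?mulr_ge0//.
rewrite -[leLHS](ger0_norm S0) -Sv (le_trans (cauchy_schwarz _ _))//.
by rewrite mulrAC ler_wpM2r// AM.
Qed.

Lemma bessel (b : nat -> H) x n : orthonormal_seq dot b ->
  \sum_(0 <= k < n) `|dot x (b k)| ^+ 2 <= `|x| ^+ 2.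
Proof.
move=> ob; have := @bessel_op b idfun 1 x n ob ler01.
rewrite mul1r; under eq_bigr do rewrite norm_dotC.
by apply=> z; rewrite mul1r.
Qed.

End InnerProduct.

(** * Bounded operators and weak convergence *)
Section Convergence.
Variables (R : realType) (H : completeNormedModType R[i]).
Variable dot : {dot H for (@Num.conj R[i])}.
Hypothesis dot_norm : hilbert_norm dot.

Lemma gt0_realE (e : R[i]) : 0 < e -> exists2 r : R, 0 < r & e = r%:C.
Proof.
move=> e0; exists (complex.Re e); first by case: e e0 => a b; rewrite ltcE => /andP[].
by rewrite RRe_real// gtr0_real.
Qed.

Lemma cvg_sumn (V : normedModType R[i]) (f : nat -> nat -> V) (l : nat -> V) K :
  (forall k, f k @ \oo --> l k) ->
  (\sum_(0 <= k < K) f k n) @[n --> \oo] --> \sum_(0 <= k < K) l k.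
Proof.
move=> fl; elim: K => [|K IH].
  by under eq_fun do rewrite big_nil; rewrite big_nil; exact: cvg_cst.
under eq_fun do rewrite big_nat_recr//=.
by rewrite big_nat_recr//=; exact: cvgD.
Qed.

Definition op_bound (A : {linear H -> H}) (M : R[i]) :=
  0 <= M /\ forall x, `|A x| <= M * `|x|.

Lemma cvg_lipschitz (V W : normedModType R[i]) (f : V -> W) (M : R[i])
    (u : nat -> V) (x : V) :
  0 <= M -> (forall y z, `|f y - f z| <= M * `|y - z|) ->
  u @ \oo --> x -> (fun n => f (u n)) @ \oo --> f x.
Proof.
move=> M0 fM /cvgrPdist_le ux; apply/cvgrPdist_le => e e0.
have M1 : 0 < M + 1 by rewrite ltr_wpDl.
have := ux (e / (M + 1)) (divr_gt0 e0 M1); apply: filterS => n.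
rewrite ler_pdivlMr// mulrC => /(le_trans _); apply.
by apply: (le_trans (fM _ _)); rewrite ler_wpM2r// lerDl.
Qed.

Lemma cvg_op (A : {linear H -> H}) M (u : nat -> H) x : op_bound A M ->
  u @ \oo --> x -> (fun n => A (u n)) @ \oo --> A x.
Proof.
by case=> M0 AM; apply: (@cvg_lipschitz _ _ _ M) => // y z; rewrite -linearB.
Qed.

Lemma cvg_dotl (u : nat -> H) x y : u @ \oo --> x ->
  (fun n => dot (u n) y : R[i]^o) @ \oo --> (dot x y : R[i]^o).
Proof.
apply: (@cvg_lipschitz _ _ (fun x => dot x y : R[i]^o) `|y|) => // v w.
by rewrite -dotBl mulrC cauchy_schwarz.
Qed.

Definition oproj (e : nat -> H) (n : nat) (x : H) : H :=
  \sum_(0 <= k < n) dot x (e k) *: e k.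

Lemma oproj_linear e n : linear (oproj e n).
Proof.
move=> a x y; rewrite /oproj scaler_sumr -big_split; apply: eq_bigr => k _ /=.
by rewrite dotDl dotZl scalerDl scalerA.
Qed.
HB.instance Definition _ e n :=
  GRing.isLinear.Build R[i] H H _ (oproj e n) (oproj_linear e n).

Lemma oproj_contr e n x : orthonormal_seq dot e -> `|oproj e n x| <= `|x|.
Proof.
move=> oe; rewrite -(@ler_pXn2r _ 2)// ?nnegrE//.
by rewrite (norm_lincomb dot_norm)// bessel.
Qed.

Lemma oproj_cvg e : orthonormal_basis dot e -> forall x, (oproj e n x) @[n --> \oo] --> x.
Proof. by case. Qed.

(** An orthonormal sequence is weakly null: the squares of these numbers have
    bounded partial sums by Bessel's inequality. *)
Lemma dot_op_orthonormal_cvg0 (e : nat -> H) (A : {linear H -> H}) M y :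
  orthonormal_seq dot e -> op_bound A M ->
  (dot (A (e n)) y : R[i]^o) @[n --> \oo] --> (0 : R[i]^o).
Proof.
move=> oe [M0 AM].
pose a n : R := complex.Re (`|dot (A (e n)) y| ^+ 2).
have aE n : (a n)%:C = `|dot (A (e n)) y| ^+ 2.
  by rewrite RRe_real// rpredX// normr_real.
have a0 n : 0 <= a n by rewrite -lecR aE exprn_ge0.
have sa : series a n @[n --> \oo] --> limn (series a).
  apply: nondecreasing_is_cvgn.
    by apply/nondecreasing_seqP => n; rewrite -subr_ge0 seriesSB.
  exists (complex.Re ((M * `|y|) ^+ 2)) => _ [n _ <-].
  rewrite -lecR RRe_real; last by rewrite rpredX// rpredM// ?ger0_real.
  rewrite rmorph_sum /=; under eq_bigr do rewrite aE.
  exact: bessel_op.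
have /cvgrPdist_lt al : a @ \oo --> 0 by apply/cvg_series_cvg_0/cvgP/sa.
apply/cvgrPdist_le => _ /gt0_realE[r r0 ->].
have := al (r ^+ 2) (exprn_gt0 _ r0); apply: filterS => n.
rewrite !sub0r !normrN ger0_norm// -ltcR aE rmorphXn /= => /ltW.
by rewrite ler_pXn2r// ?nnegrE ?lecR ?ltW// ltcR.
Qed.

(** Weak operator convergence to c A.  Testing with dot (B x) y for all bounded
    B lets a bounded operator be absorbed into the test functional, where an
    adjoint would otherwise be called for. *)
Definition wcvg (An : nat -> {linear H -> H}) (c : R[i]) (A : {linear H -> H}) :=
  forall (B : {linear H -> H}) M, op_bound B M -> forall x y,
   (dot (B (An n x)) y : R[i]^o) @[n --> \oo] --> (c * dot (B (A x)) y : R[i]^o).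

(** Uniform boundedness reduces weak convergence to the basis vectors, whose
    finite combinations are dense. *)
Lemma cvg0_on_basis (e : nat -> H) (An : nat -> {linear H -> H}) M y :
  orthonormal_basis dot e -> (forall n, op_bound (An n) M) ->
  (forall k, (dot (An n (e k)) y : R[i]^o) @[n --> \oo] --> (0 : R[i]^o)) ->
  forall x, (dot (An n x) y : R[i]^o) @[n --> \oo] --> (0 : R[i]^o).
Proof.
move=> be AM Ae x; apply/cvgrPdist_le => _ /gt0_realE[r r0 ->].
have M0 : 0 <= M by case: (AM 0%N).
have Mp : 0 < M * `|y| + 1 by rewrite ltr_wpDl// mulr_ge0.
have r20 : 0 < (r / 2)%:C :> R[i] by rewrite ltcR divr_gt0.
have /cvgrPdist_le /(_ _ (divr_gt0 r20 Mp)) [K _ /(_ K (leqnn _)) /= xK] :=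
  @oproj_cvg _ be x.
have : (\sum_(0 <= k < K) dot (An n (dot x (e k) *: e k)) y : R[i]^o)
       @[n --> \oo] --> (\sum_(0 <= k < K) 0 : R[i]^o).
  apply: (@cvg_sumn R[i]^o (fun k n => dot (An n (dot x (e k) *: e k)) y) (fun=> 0)) => k.
  under eq_fun do rewrite opZ dotZl.
  by rewrite -(mulr0 (dot x (e k))); apply: cvgMr; exact: Ae.
rewrite big1_eq; under eq_fun do rewrite -dot_suml -linear_sum -/(oproj _ _ _).
move/cvgrPdist_le => /(_ _ r20); apply: filterS => n.
rewrite !sub0r !normrN => le1.
rewrite -(subrK (oproj e K x) x) linearD dotDl (le_trans (ler_normD _ _))//.
have -> : r%:C = (r / 2)%:C + (r / 2)%:C :> R[i].
  by rewrite -rmorphD /=; congr (_%:C); field.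
apply: lerD => //; apply: (le_trans (cauchy_schwarz dot_norm _ _)).
have [_ /(_ (x - oproj e K x)) Anx] := AM n.
apply: (le_trans (ler_wpM2r (normr_ge0 y) Anx)).
rewrite mulrAC; apply: (le_trans (ler_wpM2l _ xK)); first exact: mulr_ge0.
by rewrite mulrCA ger_pMr// ler_pdivrMr// mul1r lerDl.
Qed.

End Convergence.

(** * Compact operators *)
Section CompactOperators.
Variables (R : realType) (H : completeNormedModType R[i]).
Variable dot : {dot H for (@Num.conj R[i])}.
Hypothesis dot_norm : hilbert_norm dot.

Lemma compact_op_net (T : {linear H -> H}) (e : R[i]) : compact_op T -> 0 < e ->
  exists s : seq H, forall x, `|x| <= 1 -> exists2 y, y \in s & `|T x - y| <= e.
Proof.
rewrite /compact_op precompactE compact_cover => cT e0.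
have [] := cT H setT (fun y => (ball y e)^°).
- by move=> y _; exact: open_interior.
- move=> y _; exists y => //; exact: nbhsx_ballx.
move=> D _ TD; exists (finmap.enum_fset D) => x x1.
have /TD[y yD /interior_subset] : closure (T @` [set x | `|x| <= 1]) (T x).
  by apply: subset_closure; exists x.
rewrite -ball_normE /= distrC => /ltW yx; exists y => //.
Qed.

Lemma compact_op_bounded (T : {linear H -> H}) : compact_op T ->
  exists M, op_bound T M.
Proof.
move=> /compact_op_net /(_ ltr01) [s Ts].
pose M : R[i] := \sum_(y <- s) `|y| + 1.
have M0 : 0 <= M by rewrite addr_ge0// sumr_ge0.
exists M; split=> // x.
have [->|x0] := eqVneq x 0; first by rewrite linear0 !normr0 mulr0.
have nx0 : 0 < `|x| by rewrite normr_gt0.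
have [|y ys Ty] := Ts (`|x|^-1 *: x).
  by rewrite normrZ normfV normr_id mulVf// gt_eqF.
rewrite -ler_pdivrMr// mulrC.
have -> : `|x|^-1 * `|T x| = `|T (`|x|^-1 *: x)|.
  by rewrite opZ normrZ normfV normr_id.
rewrite -(subrK y (T _)) (le_trans (ler_normD _ _))// addrC lerD//.
by rewrite (big_rem y)//= lerDl sumr_ge0.
Qed.

(** A compact operator maps bounded weakly null sequences to norm null ones.
    If y is the point of a finite d-net closest to T u_n (up to scaling), then
    |T u_n|^2 = dot (T u_n) y + dot (T u_n) (T u_n - y); the first term is small
    for all of the finitely many y at once, the second is O(d). *)
Lemma compact_op_wcvg (T : {linear H -> H}) (u : nat -> H) (r : R[i]) :
  compact_op T -> (forall n, `|u n| <= r) ->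
  (forall B M y, op_bound B M ->
     (dot (B (u n)) y : R[i]^o) @[n --> \oo] --> (0 : R[i]^o)) ->
  (T (u n)) @[n --> \oo] --> (0 : H).
Proof.
move=> cT ur u0; have [M MT] := compact_op_bounded cT; have [M0 TM] := MT.
have r0 : 0 <= r by apply: le_trans (ur 0%N).
have r1 : 0 < r + 1 by rewrite ltr_wpDl.
apply/cvgrPdist_le => e e0.

have Dr : 0 < M * (r + 1) * (r + 1) + 1 by rewrite ltr_wpDl// !mulr_ge0// ltW.
(* The net of radius d1 serves the unit ball; rescaled to the ball of radius
   r + 1 it has radius (r + 1) d1, and is multiplied by |T u_n| <= M (r + 1). *)
pose d1 := e ^+ 2 / 2 / (M * (r + 1) * (r + 1) + 1).
have e2 : 0 < e ^+ 2 / 2 by rewrite divr_gt0// exprn_gt0.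
have d10 : 0 < d1 by rewrite divr_gt0.
have [s Ts] := compact_op_net cT d10.
have /cvgrPdist_le /(_ _ e2) :
    (\sum_(0 <= k < size s) `|dot (T (u n)) (nth 0 s k)| * (r + 1) : R[i]^o)
    @[n --> \oo] --> (\sum_(0 <= k < size s) 0 : R[i]^o).
  apply: (@cvg_sumn R R[i]^o
    (fun k n => `|dot (T (u n)) (nth 0 s k)| * (r + 1)) (fun=> 0)) => k.
  rewrite -(mul0r (r + 1)) -(normr0 R[i]^o); apply: cvgMl; apply: cvg_norm.
  exact: (u0 _ _ _ MT).
apply: filterS => n; rewrite big1_eq !sub0r !normrN => le1'.
have {le1'} le1 : `|\sum_(0 <= k < size s)
    `|dot (T (u n)) (nth 0 s k)| * (r + 1)| <= e ^+ 2 / 2 by exact: le1'.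
rewrite -(@ler_pXn2r _ 2)// ?nnegrE ?(ltW e0)//.
have [|y ys Ty] := Ts ((r + 1)^-1 *: u n).
  rewrite normrZ gtr0_norm ?invr_gt0// mulrC ler_pdivrMr// mul1r.
  by rewrite (le_trans (ur n))// lerDl.
have -> : `|T (u n)| ^+ 2 = dot (T (u n)) ((r + 1) *: y)
     + dot (T (u n)) (T (u n) - (r + 1) *: y).
  by rewrite -dotDr addrC subrK dot_norm.
have E : `|T (u n) - (r + 1) *: y| <= (r + 1) * d1.
  have -> : T (u n) - (r + 1) *: y = (r + 1) *: (T ((r + 1)^-1 *: u n) - y).
    by rewrite (opZ T) scalerBr scalerA divff ?scale1r// gt_eqF.
  by rewrite normrZ gtr0_norm// ler_wpM2l// ltW.
have : `|dot (T (u n)) ((r + 1) *: y)| <= e ^+ 2 / 2.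
  apply: le_trans le1; rewrite [leRHS]ger0_norm; last first.
    by rewrite sumr_ge0// => k _; rewrite mulr_ge0// ltW.
  rewrite dotZr normrM norm_conjC (gtr0_norm r1) mulrC.
  rewrite -(nth_index 0 ys) big_mkord.
  rewrite (bigD1 (Ordinal (etrans (index_mem _ _) ys)))//= lerDl.
  by rewrite sumr_ge0// => k _; rewrite mulr_ge0// ltW.
have : `|dot (T (u n)) (T (u n) - (r + 1) *: y)| <= e ^+ 2 / 2.
  apply: (le_trans (cauchy_schwarz dot_norm _ _)).
  have : `|T (u n)| <= M * (r + 1).
    by apply: (le_trans (TM _)); rewrite ler_wpM2l// (le_trans (ur n))// lerDl.
  move=> /ler_pM/(_ E)-/(_ (normr_ge0 _) (normr_ge0 _)) /le_trans; apply.
  rewrite mulrA /d1 mulrA ler_pdivrMr// mulrC ler_wpM2l ?lerDl//.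
  exact: ltW.
move=> a1 a2; rewrite -[X in X <= _]ger0_norm; last first.
  by rewrite -dotDr addrC subrK dot_norm exprn_ge0.
apply: (le_trans (ler_normD _ _)); apply: (le_trans (lerD a2 a1)).
by rewrite -splitr.
Qed.

End CompactOperators.

(** * Rotations converging weakly to a scalar *)
Section Rotation.
Variables (R : realType) (H : completeNormedModType R[i]).
Variable dot : {dot H for (@Num.conj R[i])}.
Hypothesis dot_norm : hilbert_norm dot.
Variable e : nat -> H.
Hypothesis oe : orthonormal_seq dot e.

(** For c^2 + s^2 = 1 this rotates every pair (e_k, e_(N+k)), k < N, to
    (c e_k + s e_(N+k), - s e_k + c e_(N+k)) and fixes the orthogonal complement;
    the formula is the identity plus the finite rank difference. *)
Definition rotation (c s : R) (N : nat) (x : H) : H :=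
  x + \sum_(0 <= k < N)
    (((c%:C - 1) * dot x (e k) - s%:C * dot x (e (N + k)%N)) *: e k +
     (s%:C * dot x (e k) + (c%:C - 1) * dot x (e (N + k)%N)) *: e (N + k)%N).

Lemma rotation_linear c s N : linear (rotation c s N).
Proof.
move=> a x y; rewrite /rotation scalerDr scaler_sumr [RHS]addrACA -big_split.
congr (_ + _); apply: eq_bigr => k _ /=.
rewrite scalerDr !scalerA [RHS]addrACA -!scalerDl !dotDl !dotZl.
by congr (_ *: _ + _ *: _); ring.
Qed.
HB.instance Definition _ c s N :=
  GRing.isLinear.Build R[i] H H _ (rotation c s N) (rotation_linear c s N).

Lemma conj_real (a : R) : Num.conj a%:C = a%:C :> R[i].
Proof. by rewrite conj_Creal// complex_real. Qed.

Lemma rotation_adj c s N x y : dot (rotation c s N x) y = dot x (rotation c (- s) N y).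
Proof.
rewrite /rotation dotDl dotDr; congr (_ + _).
rewrite dot_suml dot_sumr; apply: eq_bigr => k _ /=.
rewrite !dotDl !dotDr !dotZl !dotZr.
rewrite !(rmorphD, rmorphB, rmorphM, rmorphN, rmorph1) /= !conj_real.
by rewrite -!dotC; ring.
Qed.

Lemma dot_lincomb N (a : nat -> R[i]) j :
  dot (\sum_(0 <= k < N) a k *: e k) (e j) = if (j < N)%N then a j else 0.
Proof.
rewrite dot_suml; under eq_bigr do rewrite dotZl oe.
elim: N => [|N IH]; first by rewrite big_nil.
rewrite big_nat_recr//= IH [in RHS]ltnS eq_sym.
by case: ltngtP => [jN|jN|->]; rewrite ?mulr0 ?mulr1 ?addr0 ?add0r.
Qed.

Lemma dot_lincomb_shift N (a : nat -> R[i]) j :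
  dot (\sum_(0 <= k < N) a k *: e (N + k)%N) (e j) =
  if (N <= j < N + N)%N then a (j - N)%N else 0.
Proof.
have -> : \sum_(0 <= k < N) a k *: e (N + k)%N = \sum_(N <= k < N + N) a (k - N)%N *: e k.
  rewrite -[in RHS](add0n N) big_addn addnK; apply: eq_bigr => k _.
  by rewrite addnK addnC.
have := @dot_lincomb (N + N) (fun k => a (k - N)%N) j.
rewrite (@big_cat_nat _ _ _ N)//= ?leq_addr// dotDl.
rewrite (dot_lincomb N (fun k => a (k - N)%N)).
case: (ltnP j N) => jN /=; last by rewrite add0r => ->.
by rewrite ltn_addr// -[RHS]addr0 => /addrI.
Qed.

Lemma rotationK c s N x : c ^+ 2 + s ^+ 2 = 1 ->
  rotation c s N (rotation c (- s) N x) = x.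
Proof.
move=> cs; have csC : c%:C ^+ 2 + s%:C ^+ 2 = 1 :> R[i].
  by rewrite -!rmorphXn -rmorphD /= cs.
have sC : s%:C ^+ 2 = 1 - c%:C ^+ 2 :> R[i] by rewrite -csC addrAC subrr add0r.
set z := rotation c (- s) N x.
have zk k : (k < N)%N ->
    dot z (e k) = c%:C * dot x (e k) + s%:C * dot x (e (N + k)%N).
  move=> kN; rewrite /z /rotation big_split /= !dotDl dot_lincomb dot_lincomb_shift kN.
  by rewrite leqNgt kN /= rmorphN /=; ring.
have zNk k : (k < N)%N ->
    dot z (e (N + k)%N) = c%:C * dot x (e (N + k)%N) - s%:C * dot x (e k).
  move=> kN; rewrite /z /rotation big_split /= !dotDl dot_lincomb dot_lincomb_shift.
  by rewrite ltnNge leq_addr /= ltn_add2l kN addKn rmorphN /=; ring.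
rewrite /rotation {1}/z /rotation -addrA -[RHS]addr0; congr (_ + _).
rewrite -big_split /= big_nat big1// => k /= kN.
rewrite addrACA -!scalerDl zk// zNk// rmorphN /=.
rewrite [X in X *: _ + _](_ : _ = 0); last by ring: sC.
rewrite [X in _ + X *: _](_ : _ = 0); last by ring: sC.
by rewrite !scale0r addr0.
Qed.

Lemma rotation_norm c s N x : c ^+ 2 + s ^+ 2 = 1 -> `|rotation c s N x| = `|x|.
Proof.
move=> cs; apply/eqP; rewrite -(@eqrXn2 _ 2)//; apply/eqP.
rewrite -!dot_norm rotation_adj; congr (Dot.sort dot _ _).
by rewrite -{2}(opprK s) rotationK// sqrrN.
Qed.

(** As soon as N > k, the rotation maps e_k to c e_k + s e_(N+k), and e_(N+k)
    tends weakly to 0 as N grows. *)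
Lemma rotation_wcvg c s A M y x : orthonormal_basis dot e -> c ^+ 2 + s ^+ 2 = 1 ->
  op_bound A M ->
  (dot (A (rotation c s N x)) y : R[i]^o) @[N --> \oo] --> (c%:C * dot (A x) y : R[i]^o).
Proof.
move=> be cs AM; have [M0 MA] := AM.
pose B N : {linear H -> H} := A \o (rotation c s N \- c%:C \*: idfun).
have E N : dot (A (rotation c s N x)) y = c%:C * dot (A x) y + dot (B N x) y.
  by rewrite /B /= linearB opZ dotBl dotZl addrC subrK.
suff B0 : (dot (B N x) y : R[i]^o) @[N --> \oo] --> (0 : R[i]^o).
  under eq_fun do rewrite E.
  have := cvgD (@cvg_cst R[i]^o (c%:C * dot (A x) y) nat \oo _) B0.
  by rewrite addr0; apply.
apply: (@cvg0_on_basis _ _ _ dot_norm e B (M * (1 + `|c%:C|))) => //.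
  move=> N; split; first by rewrite mulr_ge0// addr_ge0.
  move=> z; rewrite /B /=; apply: (le_trans (MA _)).
  rewrite -mulrA ler_wpM2l// (le_trans (ler_normB _ _))//.
  by rewrite rotation_norm// normrZ mulrDl mul1r.
move=> k; have : (s%:C * dot (A (e (n + k)%N)) y : R[i]^o) @[n --> \oo] --> (0 : R[i]^o).
  rewrite -(mulr0 s%:C); apply: cvgMr.
  rewrite (cvg_shiftn k (fun n => dot (A (e n)) y : R[i]^o)).
  exact: (dot_op_orthonormal_cvg0 dot_norm y oe AM).
apply: cvg_trans; apply: near_eq_cvg; near=> N.
have kN : (k < N)%N by near: N; exact: nbhs_infty_gt.
rewrite /B /=.
have -> : rotation c s N (e k) = c%:C *: e k + s%:C *: e (N + k)%N.
  rewrite /rotation (bigD1_seq k)/= ?mem_index_iota ?iota_uniq//.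
  rewrite big1_seq ?addr0 => [|j /andP[jk]]; last first.
    rewrite mem_index_iota => /= jN; rewrite !oe eq_sym (negPf jk).
    by rewrite ltn_eqF ?ltn_addr// !mulr0 subr0 addr0 !scale0r addr0.
  rewrite !oe eqxx ltn_eqF ?ltn_addr// !mulr1 !mulr0 subr0 addr0 addrA.
  by rewrite -{1}(scale1r (e k)) -scalerDl; congr (_ *: _ + _); ring.
by rewrite addrAC subrr add0r opZ dotZl.
Unshelve. all: by end_near. Qed.

End Rotation.

(** * The trace form of a Schmidt decomposition *)
Section TraceForm.
Variables (R : realType) (H : completeNormedModType R[i]).
Variable dot : {dot H for (@Num.conj R[i])}.
Hypothesis dot_norm : hilbert_norm dot.

Definition contractive (A : {linear H -> H}) := forall x, `|A x| <= `|x|.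

Lemma contractive_bound A : contractive A -> op_bound A 1.
Proof. by move=> cA; split=> // x; rewrite mul1r. Qed.

Section Form.
Variables (s : nat -> R) (f g : nat -> H) (T : {linear H -> H}).

(** With the Schmidt decomposition x |-> sum_n s_n (dot x f_n) g_n of C, the sum
    of these terms over n is the formal value of tr(C Y T Z), by cyclicity. *)
Definition form_term (Y Z : {linear H -> H}) n : R[i]^o :=
  (s n)%:C * dot (Y (T (Z (g n)))) (f n).

(** The only property of the singular numbers that the continuity of the trace
    needs; uniformity in Y and Z replaces a bound by Schatten norms. *)
Definition uniform_tails := forall e : R[i], 0 < e -> exists M0 : nat,
  forall Y Z, contractive Y -> contractive Z -> forall m,
  \sum_(M0 <= n < m) `|form_term Y Z n| <= e.

Hypothesis tails : uniform_tails.
Hypothesis cT : compact_op T.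
Hypothesis og : orthonormal_seq dot g.

Definition trace_form Y Z : R[i]^o := limn (series (form_term Y Z)).

(** The partial sums form a Cauchy sequence of scalars.  Its limit is read off
    from the completeness of H, by multiplying with the unit vector g_0. *)
Lemma trace_form_cvg Y Z : contractive Y -> contractive Z ->
  series (form_term Y Z) @ \oo --> trace_form Y Z.
Proof.
move=> cY cZ; suff [L /cvgP//] :
  exists L : R[i]^o, series (form_term Y Z) @ \oo --> L.
pose u n : H := form_term Y Z n *: g 0%N.
have g1 : `|g 0%N| = 1.
  by apply/eqP; rewrite -(@eqrXn2 _ 2)// -dot_norm og expr1n.
have /cauchy_cvg/cvg_ex[h uh] : cauchy (series u @ \oo).
  apply/cauchy_seriesP => e e0.
  have e20 : 0 < e / 2 by rewrite divr_gt0.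
  have [M0 HM] := tails e20.
  exists ([set n | (M0 <= n)%N], setT); first by split=> //; exists M0.
  move=> [m n] [/= Mm _]; rewrite (@le_lt_trans _ _ (e / 2))//; last first.
    by rewrite ltr_pdivrMr// ltr_pMr// ltr1n.
  rewrite (le_trans (ler_norm_sum _ _ _))//.
  apply: le_trans (HM Y Z cY cZ n).
  have [mn|nm] := leqP m n; last first.
    by rewrite big_geq ?sumr_ge0// ltnW.
  rewrite [leRHS](@big_cat_nat _ _ _ m)//= ler_wpDl ?sumr_ge0//.
  by apply: ler_sum => k _; rewrite normrZ g1 mulr1.
exists (dot h (g 0%N)).
have := @cvg_dotl _ _ _ dot_norm _ _ (g 0%N) uh; apply: cvg_trans.
apply: near_eq_cvg; near=> n.
rewrite /series /= dot_suml; apply: eq_bigr => k _.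
by rewrite /u dotZl og eqxx mulr1.
Unshelve. all: by end_near. Qed.

Lemma trace_form_tail Y Z e M0 : contractive Y -> contractive Z -> 0 < e ->
  (forall m, \sum_(M0 <= n < m) `|form_term Y Z n| <= e) ->
  `|trace_form Y Z - series (form_term Y Z) M0| <= e + e.
Proof.
move=> cY cZ e0 He.
have /cvgrPdist_le /(_ _ e0) [N _ /(_ (maxn N M0) (leq_maxl _ _)) /= le1] :=
  trace_form_cvg cY cZ.
rewrite -(subrK (series (form_term Y Z) (maxn N M0)) (trace_form _ _)) -addrA.
rewrite (le_trans (ler_normD _ _))// lerD//.
rewrite sub_series_geq ?leq_maxr// (le_trans (ler_norm_sum _ _ _))//.
Qed.

(** Split Z_n g = (Z_n g - c Z g) + c Z g.  The first part is weakly null, so T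
    makes it norm null and the contractions Y_n keep it so; on the second part
    only Y_n varies. *)
Lemma form_term_cvg (Yn Zn : nat -> {linear H -> H}) Y Z c k :
  (forall n, contractive (Yn n)) -> (forall n, contractive (Zn n)) ->
  contractive Z -> wcvg dot Yn c Y -> wcvg dot Zn c Z ->
  (form_term (Yn n) (Zn n) k) @[n --> \oo] --> (c * c * form_term Y Z k : R[i]^o).
Proof.
move=> cYn cZn cZ wY wZ; rewrite /form_term.
suff D : (dot (Yn n (T (Zn n (g k)))) (f k) : R[i]^o) @[n --> \oo] -->
  (c * c * dot (Y (T (Z (g k)))) (f k) : R[i]^o).
  by rewrite mulrCA; apply: cvgMr D.
pose u n := Zn n (g k) - c *: Z (g k).
have Tu : T (u n) @[n --> \oo] --> (0 : H).
  apply: (@compact_op_wcvg _ _ _ dot_norm _ _ ((1 + `|c|) * `|g k|)) => //.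
    move=> n; rewrite /u (le_trans (ler_normB _ _))// mulrDl mul1r.
    by apply: lerD; [exact: cZn|rewrite normrZ ler_wpM2l].
  move=> B M y BM; rewrite /u.
  have := cvgB (wZ B M BM (g k) y) (@cvg_cst R[i]^o (c * dot (B (Z (g k))) y) nat \oo _).
  rewrite subrr => /(_ _ _); apply: cvg_trans; apply: near_eq_cvg; near=> n.
  by rewrite linearB opZ dotBl dotZl.
have YTu : (dot (Yn n (T (u n))) (f k) : R[i]^o) @[n --> \oo] --> (0 : R[i]^o).
  rewrite -(dot0l dot (f k)); apply: (cvg_dotl dot_norm).
  apply/cvgrPdist_le => e e0; move/cvgrPdist_le : Tu => /(_ e e0).
  by apply: filterS => n; rewrite !sub0r !normrN; apply: le_trans; exact: cYn.
have i1 : op_bound (idfun : {linear H -> H}) 1 by split=> // x; rewrite mul1r.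
have YT : (c * dot (Yn n (T (Z (g k)))) (f k) : R[i]^o) @[n --> \oo] -->
    (c * (c * dot (Y (T (Z (g k)))) (f k)) : R[i]^o).
  by apply: cvgMr; exact: (wY _ _ i1 (T (Z (g k))) (f k)).
have := cvgD YTu YT; rewrite add0r mulrA => /(_ _ _); apply: cvg_trans.
apply: near_eq_cvg; near=> n.
by rewrite fctE /u linearB opZ linearB opZ dotBl dotZl subrK.
Unshelve. all: by end_near. Qed.

(** Termwise limits pass to the sum because the tails are uniformly small. *)
Lemma trace_form_continuous (Yn Zn : nat -> {linear H -> H}) Y Z c :
  `|c| <= 1 ->
  (forall n, contractive (Yn n)) -> (forall n, contractive (Zn n)) ->
  contractive Y -> contractive Z -> wcvg dot Yn c Y -> wcvg dot Zn c Z ->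
  (trace_form (Yn n) (Zn n)) @[n --> \oo] --> (c * c * trace_form Y Z : R[i]^o).
Proof.
move=> c1 cYn cZn cY cZ wY wZ; apply/cvgrPdist_le => e e0.
have e5 : 0 < e / 5%:R by rewrite divr_gt0// ltr0n.
have [M0 HM] := tails e5.
have : series (form_term (Yn n) (Zn n)) M0 @[n --> \oo] -->
  (\sum_(0 <= k < M0) (c * c * form_term Y Z k) : R[i]^o).
  by apply: (@cvg_sumn R R[i]^o (fun k n => form_term (Yn n) (Zn n) k)) => k;
     exact: form_term_cvg.
move/cvgrPdist_le => /(_ _ e5); apply: filterS => n.
rewrite -mulr_sumr => le1.
have t1 := trace_form_tail cY cZ e5 (HM _ _ cY cZ).
have t2 := trace_form_tail (cYn n) (cZn n) e5 (HM _ _ (cYn n) (cZn n)).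
set a := trace_form Y Z in t1 *; set b := trace_form (Yn n) (Zn n) in t2 *.
set a' := series _ _ in t1; set b' := series _ _ in t2 le1.
(* Two tails of size at most 2 e / 5 each, and a finite sum off by e / 5. *)
have -> : c * c * a - b = c * c * (a - a') + (c * c * a' - b') + (b' - b) by ring.
have -> : e = (e / 5%:R + e / 5%:R) + e / 5%:R + (e / 5%:R + e / 5%:R) by field.
rewrite (le_trans (ler_normD _ _))// lerD//; last by rewrite distrC.
rewrite (le_trans (ler_normD _ _))// lerD//.
apply: le_trans t1; rewrite normrM ler_piMl// normrM.
by rewrite mulr_ile1.
Qed.

End Form.

End TraceForm.

(** * The trace form is a trace *)
Section HasTrace.
Variables (R : realType) (H : completeNormedModType R[i]).
Variable dot : {dot H for (@Num.conj R[i])}.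
Hypothesis dot_norm : hilbert_norm dot.

Lemma wcvg_cst A : wcvg dot (fun=> A) 1 A.
Proof.
by move=> B M BM x y; rewrite mul1r; exact: (@cvg_cst R[i]^o).
Qed.

Lemma wcvg_oproj e (A : {linear H -> H}) : orthonormal_basis dot e ->
  contractive A ->
  wcvg dot (fun n => A \o oproj dot e n) 1 A.
Proof.
move=> be cA B M BM x y; rewrite mul1r; apply: (cvg_dotl dot_norm).
apply: (cvg_op BM); apply: (cvg_op (contractive_bound cA)).
exact: oproj_cvg.
Qed.

Lemma contractive_oproj e (A : {linear H -> H}) n : orthonormal_seq dot e ->
  contractive A -> contractive (A \o oproj dot e n).
Proof. by move=> oe cA x; apply: (le_trans (cA _)); exact: (oproj_contr dot_norm). Qed.

(** The n-th partial sum of the diagonal along e is the trace form at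
    (Y, Z P_n), where P_n is the projection onto e_0, ..., e_(n-1); now use
    P_n -> id and the continuity of the trace form. *)
Lemma has_trace_schmidt_left (C T Y Z : {linear H -> H}) s f g :
  schmidt_decomposition dot C s f g -> uniform_tails dot s f g T ->
  compact_op T -> contractive Y -> contractive Z ->
  has_trace dot (fun x => C (Y (T (Z x)))) (trace_form dot s f g T Y Z).
Proof.
move=> [of_ og SC] tails cT cY cZ e be; have [oe _] := be.
have cZn n := contractive_oproj n oe cZ.
have E n : trace_form dot s f g T Y (Z \o oproj dot e n) =
    series (fun k => dot (C (Y (T (Z (e k))))) (e k) : R[i]^o) n.
  apply: (@cvg_unique _ (@norm_hausdorff _ R[i]^o) _ _ _ _
            (trace_form_cvg dot_norm tails og cY (cZn n))).
  rewrite /series /=.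
  have := @cvg_sumn R R[i]^o (fun k m => dot (\sum_(0 <= j < m)
     ((s j)%:C * dot (Y (T (Z (e k)))) (f j)) *: g j) (e k)) _ n
     (fun k => @cvg_dotl _ _ _ dot_norm _ _ (e k) (SC (Y (T (Z (e k)))))).
  apply: cvg_trans; apply: near_eq_cvg; near=> m.
  under [LHS]eq_bigr do rewrite dot_suml.
  rewrite exchange_big /=; apply: eq_bigr => j _.
  rewrite /form_term /= /oproj !linear_sum dot_suml mulr_sumr.
  by apply: eq_bigr => k _; rewrite !opZ !dotZl; ring.
have := trace_form_continuous dot_norm tails cT og _ (fun=> cY) cZn cY cZ
  (@wcvg_cst Y) (wcvg_oproj be cZ).
rewrite normr1 !mul1r => /(_ (lexx 1)); apply: cvg_trans.
by apply: near_eq_cvg; near=> n; exact: E.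
Unshelve. all: by end_near. Qed.

(** Here T is decomposed instead of C, and tr(C Y T Z) is expanded as the
    formal value of tr(T Z C Y); the projection now sits between Z and C. *)
Lemma has_trace_schmidt_right (C T Y Z : {linear H -> H}) s f g :
  schmidt_decomposition dot T s f g -> uniform_tails dot s f g C ->
  compact_op C -> contractive Y -> contractive Z ->
  has_trace dot (fun x => C (Y (T (Z x)))) (trace_form dot s f g C Z Y).
Proof.
move=> [of_ og ST] tails cC cY cZ e be; have [oe _] := be.
have cZn n := contractive_oproj n oe cZ.
have [M CM] := compact_op_bounded cC.
have YM := contractive_bound cY.
have E n : trace_form dot s f g C (Z \o oproj dot e n) Y =
    series (fun k => dot (C (Y (T (Z (e k))))) (e k) : R[i]^o) n.
  apply: (@cvg_unique _ (@norm_hausdorff _ R[i]^o) _ _ _ _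
            (trace_form_cvg dot_norm tails og (cZn n) cY)).
  rewrite /series /=.
  have := @cvg_sumn R R[i]^o (fun k m => dot (C (Y (\sum_(0 <= j < m)
     ((s j)%:C * dot (Z (e k)) (f j)) *: g j))) (e k)) _ n
     (fun k => @cvg_dotl _ _ _ dot_norm _ _ (e k) (cvg_op CM (cvg_op YM (ST (Z (e k)))))).
  apply: cvg_trans; apply: near_eq_cvg; near=> m.
  under [LHS]eq_bigr do rewrite !linear_sum dot_suml.
  rewrite exchange_big /=; apply: eq_bigr => j _.
  rewrite /form_term /= /oproj !linear_sum dot_suml mulr_sumr.
  by apply: eq_bigr => k _; rewrite !opZ !dotZl; ring.
have := trace_form_continuous dot_norm tails cC og _ cZn (fun=> cY) cZ cY
  (wcvg_oproj be cZ) (@wcvg_cst Y).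
rewrite normr1 !mul1r => /(_ (lexx 1)); apply: cvg_trans.
by apply: near_eq_cvg; near=> n; exact: E.
Unshelve. all: by end_near. Qed.

End HasTrace.

(** * Uniformly small tails *)
Section Tails.
Variable R : realType.

Lemma bounded_series_tail (a : nat -> R) (B eps : R) :
  (forall n, 0 <= a n) -> (forall n, \sum_(0 <= k < n) a k <= B) -> 0 < eps ->
  exists M0 : nat, forall m, \sum_(M0 <= k < m) a k <= eps.
Proof.
move=> a0 aB e0.
have nd : nondecreasing_seq (series a).
  by apply/nondecreasing_seqP => n; rewrite -subr_ge0 seriesSB.
have sa : cvgn (series a).
  by apply: nondecreasing_is_cvgn => //; exists B => _ [n _ <-]; exact: aB.
have /cvgrPdist_le /(_ _ e0) [M0 _ /(_ M0 (leqnn _)) /= le1] := sa.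
exists M0 => m; have [M0m|mM0] := leqP M0 m; last by rewrite big_geq ?ltW// ltnW.
rewrite -sub_series_geq//; apply: le_trans le1; apply: le_trans (ler_norm _).
by rewrite lerD2r; exact: nondecreasing_cvgn_le.
Qed.

Lemma nneseries_bounded (a : nat -> R) : (forall n, 0 <= a n) ->
  (\sum_(0 <= n <oo) (a n)%:E < +oo)%E ->
  exists B, forall n, \sum_(0 <= k < n) a k <= B.
Proof.
move=> a0 aoo; exists (fine (\sum_(0 <= n <oo) (a n)%:E)%E) => n.
rewrite -lee_fin fineK; last first.
  rewrite ge0_fin_numE// nneseries_ge0// => k _ _; rewrite lee_fin//.
rewrite -sumEFin; apply: (@nneseries_lim_ge R (fun n => (a n)%:E)) => k _ _.
by rewrite lee_fin.
Qed.

(** By u v <= (u^2 + v^2) / 2 the matrix u_ij v_ij is dominated by one whose row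
    and column sums are at most 1, so summing it against al_i + be_j costs at
    most the sums of al and of be. *)
Lemma schur_test (al be : nat -> R) (u v : nat -> nat -> R) m n K :
  (forall i, 0 <= al i) -> (forall i, 0 <= be i) ->
  (forall i N, \sum_(0 <= j < N) u i j ^+ 2 <= 1) ->
  (forall i N, \sum_(0 <= j < N) v i j ^+ 2 <= 1) ->
  (forall j N, \sum_(0 <= i < N) u i j ^+ 2 <= 1) ->
  (forall j N, \sum_(0 <= i < N) v i j ^+ 2 <= 1) ->
  \sum_(m <= i < n) \sum_(0 <= j < K) (al i + be j) * (u i j * v i j) <=
  \sum_(m <= i < n) al i + \sum_(0 <= j < K) be j.
Proof.
move=> al0 be0 u1 v1 u2 v2.
pose w i j := (u i j ^+ 2 + v i j ^+ 2) / 2.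
have w0 i j : 0 <= w i j by rewrite divr_ge0// addr_ge0// sqr_ge0.
have uvw i j : u i j * v i j <= w i j.
  rewrite /w ler_pdivlMr//; have := sqr_ge0 (u i j - v i j); nra.
have w1 i N : \sum_(0 <= j < N) w i j <= 1.
  by rewrite -mulr_suml big_split /= ler_pdivrMr//; have := u1 i N; have := v1 i N; lra.
have w2 j N : \sum_(0 <= i < N) w i j <= 1.
  by rewrite -mulr_suml big_split /= ler_pdivrMr//; have := u2 j N; have := v2 j N; lra.
apply: (@le_trans _ _
  (\sum_(m <= i < n) \sum_(0 <= j < K) (al i * w i j + be j * w i j))).
  apply: ler_sum => i _; apply: ler_sum => j _.
  by rewrite -mulrDl ler_wpM2l// addr_ge0.
under eq_bigr do rewrite big_split /=.
rewrite big_split /= lerD//.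
  apply: ler_sum => i _; rewrite -mulr_sumr ler_piMr//.
rewrite exchange_big /=; apply: ler_sum => j _; rewrite -mulr_sumr ler_piMr//.
apply: le_trans (w2 j n); have [mn|nm] := leqP m n; last first.
  by rewrite big_geq ?sumr_ge0// ltnW.
by rewrite [leRHS](@big_cat_nat _ _ _ m)//= ler_wpDl ?sumr_ge0.
Qed.

Variables (H : completeNormedModType R[i]).
Variable dot : {dot H for (@Num.conj R[i])}.
Hypothesis dot_norm : hilbert_norm dot.

Lemma norm_orthonormal (f : nat -> H) n : orthonormal_seq dot f -> `|f n| = 1.
Proof.
by move=> of_; apply/eqP; rewrite -(@eqrXn2 _ 2)// -dot_norm of_ eqxx expr1n.
Qed.

Lemma uniform_tails_l1 (s : nat -> R) (f g : nat -> H) (T : {linear H -> H}) M B :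
  (forall n, 0 <= s n) -> (forall n, \sum_(0 <= k < n) s k <= B) ->
  orthonormal_seq dot f -> orthonormal_seq dot g -> op_bound T M ->
  uniform_tails dot s f g T.
Proof.
move=> s0 sB of_ og [M0 TM] _ /gt0_realE[e e0 ->].
have MR : M = (complex.Re M)%:C by rewrite RRe_real// ger0_real.
have M1 : 0 < complex.Re M + 1 by rewrite ltr_wpDl// -lecR -MR.
have [M' HM'] := bounded_series_tail s0 sB (divr_gt0 e0 M1).
exists M' => Y Z cY cZ m.
apply: (@le_trans _ _ (\sum_(M' <= n < m) ((complex.Re M + 1) * s n)%:C)).
  apply: ler_sum => n _; rewrite /form_term normrM ger0_norm ?lecR// mulrC rmorphM /=.
  apply: ler_wpM2r; first by rewrite lecR.
  apply: (le_trans (cauchy_schwarz dot_norm _ _)).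
  rewrite (norm_orthonormal n of_) mulr1 (le_trans (cY _))// (le_trans (TM _))//.
  rewrite rmorphD /= -MR; apply: (@le_trans _ _ M); last by rewrite lerDl lecR.
  by rewrite ler_piMr// (le_trans (cZ _))// (norm_orthonormal n og).
rewrite -rmorph_sum /= lecR -mulr_sumr mulrC -ler_pdivlMr//.
Qed.

(** Expanding T as well, s_n |<f_n, Y T Z g_n>| is at most
    sum_j s_n r_j |<f_n, Y b_j>| |<a_j, Z g_n>|, and Bessel's inequality makes
    these two matrices admissible for the Schur test.  Young's inequality is
    applied to the product of s_n / mu and mu r_j: a small mu makes the
    contribution of all the r_j small, and then the tail of sum_n s_n^P is taken
    small enough to compensate the factor mu^-P. *)
Lemma uniform_tails_conjugate (s r : nat -> R) (f g a b : nat -> H)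
    (T : {linear H -> H}) (P Q B1 B2 : R) :
  0 < P -> 0 < Q -> P^-1 + Q^-1 = 1 ->
  (forall n, 0 <= s n) -> (forall n, \sum_(0 <= k < n) s k `^ P <= B1) ->
  (forall n, 0 <= r n) -> (forall n, \sum_(0 <= k < n) r k `^ Q <= B2) ->
  orthonormal_seq dot f -> orthonormal_seq dot g ->
  schmidt_decomposition dot T r a b ->
  uniform_tails dot s f g T.
Proof.
move=> P0 Q0 PQ s0 sB r0 rB of_ og [oa ob ST] _ /gt0_realE[e e0 ->].
have B20 : 0 <= B2 by apply: le_trans (rB 0%N); rewrite big_nil.
(* mu is chosen with mu^Q = t, so that the r-part is at most t B2 / Q <= e / 4. *)
pose t := e / 4 * Q / (B2 + 1).
have t0 : 0 < t by rewrite !mulr_gt0 ?invr_gt0 ?ltr_wpDl.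
pose mu := t `^ Q^-1.
have mu0 : 0 < mu by exact: powR_gt0.
have muQ : mu `^ Q = t by rewrite /mu -powRrM mulVf ?gt_eqF// powRr1// ltW.
have muP0 : 0 < (mu^-1) `^ P by rewrite powR_gt0// invr_gt0.
have sP0 n : 0 <= s n `^ P by exact: powR_ge0.
have eP : 0 < e / 4 * P / (mu^-1) `^ P by rewrite !mulr_gt0 ?invr_gt0.
have [M0 HM0] := bounded_series_tail sP0 sB eP.
exists M0 => Y Z cY cZ m.
(* F K n bounds the n-th term when the expansion of T is cut off at K. *)
pose F K n : R[i] := (s n)%:C *
  \sum_(0 <= j < K) (r j)%:C * (`|dot (Z (g n)) (a j)| * `|dot (Y (b j)) (f n)|).
have FK K : \sum_(M0 <= n < m) F K n <= (e / 2)%:C.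
  pose u i j := complex.Re `|dot (Z (g i)) (a j)|.
  pose v i j := complex.Re `|dot (Y (b j)) (f i)|.
  have uE i j : `|dot (Z (g i)) (a j)| = (u i j)%:C by rewrite RRe_real.
  have vE i j : `|dot (Y (b j)) (f i)| = (v i j)%:C by rewrite RRe_real.
  have toR N (h : nat -> R) (h' : nat -> R[i]) : (forall k, h' k = (h k)%:C) ->
     \sum_(0 <= k < N) h' k ^+ 2 <= 1 -> \sum_(0 <= k < N) h k ^+ 2 <= 1.
    move=> hh' le1; rewrite -lecR rmorph_sum /= rmorph1.
    by apply: le_trans le1; apply: ler_sum => k _; rewrite rmorphXn /= hh'.
  have u1 i N : \sum_(0 <= j < N) u i j ^+ 2 <= 1.
    apply: (toR _ _ _ (uE i)); apply: (le_trans (bessel dot_norm _ _ oa)).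
    by rewrite expr_le1// (le_trans (cZ _))// (norm_orthonormal _ og).
  have v1 i N : \sum_(0 <= j < N) v i j ^+ 2 <= 1.
    apply: (toR _ _ _ (vE i)).
    apply: (le_trans (bessel_op dot_norm _ _ ob ler01 (contractive_bound cY).2)).
    by rewrite mul1r (norm_orthonormal _ of_) expr1n.
  have u2 j N : \sum_(0 <= i < N) u i j ^+ 2 <= 1.
    apply: (toR _ _ _ (fun i => uE i j)).
    apply: (le_trans (bessel_op dot_norm _ _ og ler01 (contractive_bound cZ).2)).
    by rewrite mul1r (norm_orthonormal _ oa) expr1n.
  have v2 j N : \sum_(0 <= i < N) v i j ^+ 2 <= 1.
    apply: (toR _ _ _ (fun i => vE i j)); apply: (le_trans (bessel dot_norm _ _ of_)).
    by rewrite expr_le1// (le_trans (cY _))// (norm_orthonormal _ ob).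
  have u0 i j : 0 <= u i j by rewrite -lecR -uE; exact: normr_ge0.
  have v0 i j : 0 <= v i j by rewrite -lecR -vE; exact: normr_ge0.
  pose al i := (mu^-1 * s i) `^ P / P.
  pose be j := (mu * r j) `^ Q / Q.
  have al0 i : 0 <= al i by rewrite divr_ge0 ?powR_ge0// ltW.
  have be0 i : 0 <= be i by rewrite divr_ge0 ?powR_ge0// ltW.
  have -> : \sum_(M0 <= n < m) F K n =
     (\sum_(M0 <= n < m) \sum_(0 <= j < K) s n * r j * (u n j * v n j))%:C.
    rewrite rmorph_sum; apply: eq_bigr => n _; rewrite rmorph_sum /F mulr_sumr.
    by apply: eq_bigr => j _; rewrite uE vE !rmorphM /=; ring.
  rewrite lecR.
  apply: (@le_trans _ _
    (\sum_(M0 <= n < m) \sum_(0 <= j < K) (al n + be j) * (u n j * v n j))).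
    apply: ler_sum => n _; apply: ler_sum => j _.
    rewrite ler_wpM2r ?mulr_ge0//.
    have -> : s n * r j = (mu^-1 * s n) * (mu * r j).
      by rewrite mulrACA mulVf ?mul1r// gt_eqF.
    by rewrite conjugate_powR ?mulr_ge0 ?invr_ge0// ltW.
  apply: (le_trans (schur_test _ _ _ al0 be0 u1 v1 u2 v2)).
  have -> : e / 2 = e / 4 + e / 4 by field.
  apply: lerD.
    rewrite /al -mulr_suml.
    under eq_bigr do rewrite powRM ?invr_ge0 ?(ltW mu0)//.
    by rewrite -mulr_sumr ler_pdivrMr// mulrC -ler_pdivlMr//; exact: HM0.
  rewrite /be -mulr_suml.
  under eq_bigr do rewrite powRM ?(ltW mu0)// muQ.
  rewrite -mulr_sumr ler_pdivrMr// /t mulrAC ler_pdivrMr ?ltr_wpDl//.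
  by rewrite ler_wpM2l ?mulr_ge0 ?(ltW e0) ?(ltW Q0)// (le_trans (rB K))// lerDl.
have YM := contractive_bound cY.
have e2 : 0 < (e / 2)%:C :> R[i] by rewrite ltcR divr_gt0.
have L : \sum_(M0 <= n < m) `|(s n)%:C * dot (Y (\sum_(0 <= j < K)
    ((r j)%:C * dot (Z (g n)) (a j)) *: b j)) (f n) : R[i]^o| @[K --> \oo] -->
   (\sum_(M0 <= n < m) `|form_term dot s f g T Y Z n| : R[i]^o).
  have [M0m|mM0] := leqP M0 m; last first.
    rewrite big_geq ?(ltnW mM0)//; under eq_fun do rewrite big_geq ?(ltnW mM0)//.
    exact: cvg_cst.
  rewrite -(add0n M0) -(subnK M0m) big_addn.
  under eq_fun do rewrite big_addn.
  apply: (@cvg_sumn R R[i]^o) => k.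
  apply: cvg_norm; apply: cvgMr; apply: (cvg_dotl dot_norm); apply: (cvg_op YM).
  exact: ST.
move/cvgrPdist_le : L => /(_ _ e2) [K _ /(_ K (leqnn _)) /=].
set X := \sum_(_ <= _ < _) _; set X' := \sum_(_ <= _ < _) _ => XX'.
have X'F : X' <= \sum_(M0 <= n < m) F K n.
  apply: ler_sum => n _; rewrite normrM ger0_norm ?lecR// ler_wpM2l ?lecR//.
  rewrite linear_sum dot_suml (le_trans (ler_norm_sum _ _ _))//.
  apply: ler_sum => j _; rewrite opZ dotZl !normrM -mulrA ger0_norm ?lecR//.
have -> : e%:C = (e / 2)%:C + (e / 2)%:C :> R[i].
  by rewrite -rmorphD /=; congr (_%:C); field.
have X0 : 0 <= X by rewrite sumr_ge0.
have X'0 : 0 <= X' by rewrite sumr_ge0.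
rewrite -(subrK X' X) lerD//; last exact: le_trans X'F (FK K).
by apply: le_trans XX'; apply: real_ler_norm; rewrite rpredB ?ger0_real.
Qed.

End Tails.

(** * Existence of an orthonormal basis *)
Section GramSchmidt.
Variables (R : realType) (H : completeNormedModType R[i]).
Variable dot : {dot H for (@Num.conj R[i])}.
Hypothesis dot_norm : hilbert_norm dot.

Definition orthonormal_upto (e : nat -> H) n :=
  forall j k, (j < n)%N -> (k < n)%N -> dot (e j) (e k) = (j == k)%:R.

(** The vector v is a legitimate next basis vector after e_0, ..., e_(n-1), and
    with it the span contains x. *)
Definition extends_basis (e : nat -> H) n (x v : H) :=
  [/\ dot v v = 1, forall k, (k < n)%N -> dot v (e k) = 0
    & oproj dot e n x + dot x v *: v = x].

Lemma dot_oproj e n x k : orthonormal_upto e n -> (k < n)%N ->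
  dot (oproj dot e n x) (e k) = dot x (e k).
Proof.
move=> oe kn; rewrite /oproj dot_suml big_mkord (bigD1 (Ordinal kn))//=.
rewrite dotZl oe// eqxx mulr1 big1 ?addr0// => j jk.
rewrite dotZl oe//; move: jk; rewrite -val_eqE /= => /negPf ->.
by rewrite mulr0.
Qed.

(** Take the normalized residual of x; if x already lies in the span, take that
    of any y outside it, which exists by infinite dimension. *)
Lemma exists_extends_basis e n x : infinite_dimensional H ->
  orthonormal_upto e n -> exists v, extends_basis e n x v.
Proof.
move=> infH oe.
have dotP y z : (forall k, (k < n)%N -> dot z (e k) = 0) -> dot (oproj dot e n y) z = 0.
  move=> zk; rewrite /oproj dot_suml big_nat big1// => k kn.
  by rewrite dotZl [dot (e k) z]dotC zk// conjC0 mulr0.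
pose r y := y - oproj dot e n y.
have rk y k : (k < n)%N -> dot (r y) (e k) = 0.
  by move=> kn; rewrite /r dotBl dot_oproj// subrr.
have unit_r y : r y != 0 -> extends_basis e n (oproj dot e n x) (`|r y|^-1 *: r y)
    /\ (r x != 0 -> y = x -> extends_basis e n x (`|r y|^-1 *: r y)).
  move=> ry0; have nr0 : `|r y| != 0 by rewrite normr_eq0.
  have cn : Num.conj `|r y|^-1 = `|r y|^-1 by rewrite geC0_conj// invr_ge0.
  have v1 : dot (`|r y|^-1 *: r y) (`|r y|^-1 *: r y) = 1.
    by rewrite dotZl dotZr cn dot_norm; field.
  have vk k : (k < n)%N -> dot (`|r y|^-1 *: r y) (e k) = 0.
    by move=> kn; rewrite dotZl rk ?mulr0.
  split; last first.
    move=> rx0 yx; split=> //; rewrite yx in nr0 cn v1 vk *.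
    have dr : dot x (r x) = `|r x| ^+ 2.
      rewrite -{1}(subrK (oproj dot e n x) x) dotDl -/(r x) dot_norm.
      by rewrite dotP ?addr0//; exact: rk.
    have -> : dot x (`|r x|^-1 *: r x) = `|r x| by rewrite dotZr cn dr; field.
    by rewrite scalerA divff// scale1r addrC subrK.
  split=> //; rewrite dotP// scale0r addr0.
  by rewrite /oproj; apply: eq_big_nat => k /= kn; rewrite -/(oproj dot e n x) dot_oproj.
have [rx0|rx0] := eqVneq (r x) 0; last first.
  by exists (`|r x|^-1 *: r x); apply: (unit_r x rx0).2.
have xP : x = oproj dot e n x by apply/eqP; rewrite -subr_eq0 -/(r x) rx0.
suff [y ry0] : exists y, r y != 0.
  by exists (`|r y|^-1 *: r y); have [] := unit_r y ry0; rewrite -xP.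
apply: contra_notP infH => noy; exists n, (fun i => e i) => y.
exists (fun i => dot y (e i)).
have /eqP : r y == 0 by apply: contra_notT noy => ry0; exists y.
by move/eqP; rewrite subr_eq0 /oproj big_mkord => /eqP.
Qed.

(** Gram-Schmidt along a dense sequence d: e_n is chosen so that d_n lies in the
    span of e_0, ..., e_n.  No vector is skipped, since a redundant d_n is
    replaced by an arbitrary new direction. *)
Lemma exists_orthonormal_basis : infinite_dimensional H -> separable H ->
  exists e, orthonormal_basis dot e.
Proof.
move=> infH [D /pcard_injP[idx idx_inj] dD].
pose d n := xget 0 [set x | D x /\ idx x = n].
have dE x : D x -> d (idx x) = x.
  move=> Dx; rewrite /d; case: xgetP => [y -> [Dy yx]|/(_ x)]; last by case.
  by apply: idx_inj => //; rewrite inE.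
pose next (l : seq H) x := xget 0 (extends_basis (nth 0 l) (size l) x).
(* gs n lists e_0, ..., e_(n-1). *)
pose gs := fix gs n := if n is m.+1 then rcons (gs m) (next (gs m) (d m)) else [::].
pose e n := next (gs n) (d n).
have gsE n : gs n = mkseq e n.
  by elim: n => // n IH; rewrite mkseqS -IH.
have congr_proj n x : oproj dot (nth 0 (mkseq e n)) n x = oproj dot e n x.
  by apply: eq_big_nat => k kn; rewrite nth_mkseq.
have eP n : orthonormal_upto e n -> extends_basis e n (d n) (e n).
  move=> oe; have oe' : orthonormal_upto (nth 0 (mkseq e n)) n.
    by move=> j k jn kn; rewrite !nth_mkseq// oe.
  have [v vP] := exists_extends_basis (d n) infH oe'.
  rewrite {2}/e /next gsE size_mkseq; case: xgetP => [w _ [w1 wk wd]|/(_ v)//].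
  by split=> // [k kn|]; [rewrite -(wk k kn) nth_mkseq | rewrite -congr_proj].
have oe n : orthonormal_upto e n.
  elim: n => // n IH j k; have [n1 nk _] := eP n IH.
  rewrite ltnS leq_eqVlt => /predU1P[->|jn]; rewrite ltnS leq_eqVlt => /predU1P[->|kn].
  - by rewrite n1 eqxx.
  - by rewrite nk// gtn_eqF.
  - by rewrite dotC nk// conjC0 ltn_eqF.
  - exact: IH.
have oe' : orthonormal_seq dot e.
  by move=> j k; apply: (oe (maxn j k).+1); rewrite ltnS ?leq_maxl ?leq_maxr.
have dP n : oproj dot e n.+1 (d n) = d n.
  by have [_ _ dn] := eP n (oe n); rewrite -[RHS]dn /oproj big_nat_recr.
have dPm n m : (n < m)%N -> oproj dot e m (d n) = d n.
  move=> nm; rewrite -[RHS]dP /oproj (@big_cat_nat _ _ _ n.+1)//=.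
  rewrite [X in _ + X]big_nat [X in _ + X]big1 ?addr0// => k /andP[nk _].
  rewrite -dP /oproj dot_suml big_nat big1 ?scale0r// => j /= jn.
  by rewrite dotZl oe' ltn_eqF ?mulr0// (leq_trans jn).
exists e; split=> // x; apply/cvgrPdist_le => eps eps0.
have e2 : 0 < eps / 2 by rewrite divr_gt0.
have [||y [/interior_subset + Dy]] := dD ((ball x (eps / 2))^°).
- by exists x; exact: nbhsx_ballx.
- exact: open_interior.
rewrite -ball_normE /= -(dE y Dy) => /ltW xd.
exists (idx y).+1 => // m /= nm; rewrite -/(oproj dot e m x).
have -> : x - oproj dot e m x = (x - d (idx y)) - oproj dot e m (x - d (idx y)).
  have -> : oproj dot e m (x - d (idx y)) = oproj dot e m x - d (idx y).
    by rewrite -{2}(dPm _ _ nm); exact: linearB.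
  by rewrite opprB addrA subrK.
rewrite (splitr eps) (le_trans (ler_normB _ _))// lerD//.
by rewrite (le_trans (oproj_contr dot_norm _ _ oe')).
Qed.

End GramSchmidt.

(** * Unitary operators and traces *)
Section UnitaryOperators.
Variables (R : realType) (H : completeNormedModType R[i]).
Variable dot : {dot H for (@Num.conj R[i])}.
Hypothesis dot_norm : hilbert_norm dot.

Lemma dot_inj x y : (forall z, dot z x = dot z y) -> x = y.
Proof.
move=> xy; apply/eqP; rewrite -subr_eq0 -normr_eq0 -(@eqrXn2 _ 2)//.
by rewrite -dot_norm dotBr xy subrr expr0n.
Qed.

Lemma adjointE (A : H -> H) y z : (forall x, dot (A x) y = dot x z) ->
  adjoint dot A y = z.
Proof.
move=> Az; rewrite /adjoint; case: xgetP => [w _ Aw|/(_ z)//].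
by apply: dot_inj => x; rewrite -Aw Az.
Qed.

(** The vector adjoint(y) is a genuine adjoint vector, or the default 0; in the
    latter case y = U 0 = 0, for which 0 is an adjoint vector anyway. *)
Lemma unitary_adjoint (U : {linear H -> H}) x y : unitary dot U ->
  dot (U x) y = dot x (adjoint dot U y).
Proof.
case=> _ _ /(_ y) /=; rewrite /adjoint; case: xgetP => [z _ Uz _|_ U0].
  exact: Uz.
by rewrite -U0 linear0 !dot0r.
Qed.

(** A unitary operator and its adjoint are mutually inverse linear isometries;
    linearity of the adjoint comes from that of its inverse U. *)
Lemma unitaryP (U : {linear H -> H}) : unitary dot U ->
  exists U' : {linear H -> H},
    [/\ contractive U, contractive U', adjoint dot U = U', cancel U U' & cancel U' U].
Proof.
move=> uU; have [_ aU Ua] := uU.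
have lin : linear (adjoint dot U).
  by move=> c x y; rewrite -{1}(Ua x) -{1}(Ua y) /= -linearP -[LHS]/((_ \o U) _) aU.
pose U' : {linear H -> H} := HB.pack (adjoint dot U)
  (GRing.isLinear.Build R[i] H H _ (adjoint dot U) lin).
have nU x : `|U x| = `|x|.
  apply/eqP; rewrite -(@eqrXn2 _ 2)// -!dot_norm unitary_adjoint//.
  by rewrite -[adjoint _ _ _]/((_ \o U) x) aU.
exists U'; split=> //; first by move=> x; rewrite nU.
by move=> x; have /(congr1 Num.norm) := Ua x; rewrite /= nU => <-.
Qed.

Lemma unitary_intro (U : {linear H -> H}) (U' : H -> H) :
  (forall x y, dot (U x) y = dot x (U' y)) -> cancel U U' -> cancel U' U ->
  unitary dot U /\ adjoint dot U = U'.
Proof.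
move=> UU' UK U'K; have adjU : adjoint dot U = U'.
  by apply/funext => y; apply: adjointE => x; exact: UU'.
split=> //; split; last 2 first.
- by move=> x; rewrite adjU /= UK.
- by move=> x; rewrite adjU /= U'K.
have nU x : `|U x| = `|x|.
  by apply/eqP; rewrite -(@eqrXn2 _ 2)// -!dot_norm UU' UK.
apply/linear_boundedP; near=> r => x.
rewrite nU ler_peMl//; near: r; exact: nbhs_pinfty_ge.
Unshelve. all: by end_near. Qed.

Lemma trace_eq e (A : H -> H) z : orthonormal_basis dot e -> has_trace dot A z ->
  trace dot A = z.
Proof.
move=> be Az; rewrite /trace; case: xgetP => [w _ Aw|/(_ z)//].
exact: (@cvg_unique _ (@norm_hausdorff _ R[i]^o) _ _ _ _ (Aw e be) (Az e be)).
Qed.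

(** F computes tr(C Y T Z) for contractions Y and Z and is weakly continuous, in
    a form that allows the limits to be scaled by c. *)
Definition trace_functional (C T : {linear H -> H})
    (F : {linear H -> H} -> {linear H -> H} -> R[i]^o) :=
  (forall Y Z, contractive Y -> contractive Z ->
     has_trace dot (fun x => C (Y (T (Z x)))) (F Y Z)) /\
  (forall (Yn Zn : nat -> {linear H -> H}) Y Z c, `|c| <= 1 ->
     (forall n, contractive (Yn n)) -> (forall n, contractive (Zn n)) ->
     contractive Y -> contractive Z -> wcvg dot Yn c Y -> wcvg dot Zn c Z ->
     (F (Yn n) (Zn n)) @[n --> \oo] --> (c * c * F Y Z : R[i]^o)).

Lemma trace_functional_left (C T : {linear H -> H}) s f g :
  schmidt_decomposition dot C s f g -> uniform_tails dot s f g T ->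
  compact_op T -> exists F, trace_functional C T F.
Proof.
move=> SC tails cT; have [of_ og _] := SC.
exists (trace_form dot s f g T); split.
  by move=> Y Z cY cZ; exact: (has_trace_schmidt_left dot_norm SC).
by move=> Yn Zn Y Z c; exact: trace_form_continuous.
Qed.

Lemma trace_functional_right (C T : {linear H -> H}) s f g :
  schmidt_decomposition dot T s f g -> uniform_tails dot s f g C ->
  compact_op C -> exists F, trace_functional C T F.
Proof.
move=> ST tails cC; have [of_ og _] := ST.
exists (fun Y Z => trace_form dot s f g C Z Y); split.
  by move=> Y Z cY cZ; exact: (has_trace_schmidt_right dot_norm ST).
by move=> Yn Zn Y Z c c1 cYn cZn cY cZ wY wZ; exact: trace_form_continuous.
Qed.

Lemma schatten_fin p (A : {linear H -> H}) : schatten dot p%:E A ->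
  exists s f g B, [/\ forall n, 0 <= s n, schmidt_decomposition dot A s f g
     & forall n, \sum_(0 <= k < n) s k `^ p <= B].
Proof.
case=> _ /(_ p erefl) [s [s0 _ _ [f [g sfg]]]] sp.
have [|B sB] := @nneseries_bounded _ (fun n => s n `^ p) _ sp.
  by move=> n; exact: powR_ge0.
by exists s, f, g, B.
Qed.

(** Conjugate exponents are either both finite, or {1, oo}; in the latter case
    the operator with exponent 1 is the one that gets expanded. *)
Lemma exists_trace_functional (p q : \bar R) (C T : {linear H -> H}) :
  (1 <= p)%E -> (1 <= q)%E -> (p^-1 + q^-1 = 1)%E ->
  schatten dot p C -> schatten dot q T -> exists F, trace_functional C T F.
Proof.
move=> p1 q1 pq hC hT; have [cC _] := hC; have [cT _] := hT.
have l1 r : r = 1 -> forall A, schatten dot r%:E A -> exists s f g B,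
    [/\ forall n, 0 <= s n, schmidt_decomposition dot A s f g
     & forall n, \sum_(0 <= k < n) s k <= B].
  move=> -> A /schatten_fin [s [f [g [B [s0 S sB]]]]]; exists s, f, g, B; split=> // n.
  by apply: le_trans (sB n); apply: ler_sum => k _; rewrite powRr1.
case: p q => [p||] [q||] // in p1 q1 pq hC hT *.
- have p0 : 0 < p by rewrite (lt_le_trans ltr01).
  have q0 : 0 < q by rewrite (lt_le_trans ltr01).
  have {}pq : p^-1 + q^-1 = 1.
    by move: pq; rewrite !inver !gt_eqF// -EFinD => -[].
  have [s [f [g [B1 [s0 SC sB1]]]]] := schatten_fin hC.
  have [r [a [b [B2 [r0 ST rB2]]]]] := schatten_fin hT.
  apply: (trace_functional_left SC) => //; have [of_ og _] := SC.
  exact: (uniform_tails_conjugate dot_norm p0 q0 pq s0 sB1 r0 rB2 of_ og ST).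
- have pE : p = 1.
    by move: pq; rewrite invey adde0 => /eqP; rewrite inve_eq1 => /eqP[].
  have [s [f [g [B [s0 SC sB]]]]] := l1 p pE C hC.
  have [M TM] := compact_op_bounded cT; have [of_ og _] := SC.
  apply: (trace_functional_left SC) => //.
  exact: (uniform_tails_l1 dot_norm s0 sB of_ og TM).
- have qE : q = 1.
    by move: pq; rewrite invey add0e => /eqP; rewrite inve_eq1 => /eqP[].
  have [s [f [g [B [s0 ST sB]]]]] := l1 q qE T hT.
  have [M CM] := compact_op_bounded cC; have [of_ og _] := ST.
  apply: (trace_functional_right ST) => //.
  exact: (uniform_tails_l1 dot_norm s0 sB of_ og CM).
- by move: pq; rewrite !invey adde0 => /eqP; rewrite eqe eq_sym oner_eq0.
Qed.

End UnitaryOperators.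

Theorem theorem3p6 (R : realType) (H : completeNormedModType R[i])
    (dot : {dot H for (@Num.conj R[i])}) (p q : \bar R)
    (C T : {linear H -> H}) :
  hilbert_norm dot ->
  infinite_dimensional H ->
  separable H ->
  (1 <= p)%E -> (1 <= q)%E -> (p^-1 + q^-1 = 1)%E ->
  schatten dot p C -> schatten dot q T ->
  star_shaped (closure (C_numerical_range dot C T)) 0.
Proof.
move=> dot_norm infH sepH p1 q1 pq hC hT.
have [e be] := exists_orthonormal_basis dot_norm infH sepH; have [oe _] := be.
have [F [trF contF]] := exists_trace_functional dot_norm p1 q1 pq hC hT.
set W := C_numerical_range dot C T.
(* The main step: the rotated unitaries V_N U realize t w in the limit. *)
have scaleW (w : R[i]^o) (t : R) : W w -> 0 <= t <= 1 -> closure W (t%:C * w).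
  case=> U uU -> /andP[t0 t1].
  have [U' [cU cU' adjU UK U'K]] := unitaryP dot_norm uU.
  have -> : trace dot (C \o adjoint dot U \o T \o U) = F U' U.
    by rewrite adjU; apply: (trace_eq be); exact: trF.
  pose c := Num.sqrt t; pose s := Num.sqrt (1 - t).
  have c2 : c ^+ 2 = t by rewrite sqr_sqrtr.
  have cs : c ^+ 2 + s ^+ 2 = 1 by rewrite c2 sqr_sqrtr ?subr_ge0// addrC subrK.
  have csN : c ^+ 2 + (- s) ^+ 2 = 1 by rewrite sqrrN.
  pose V N : {linear H -> H} := rotation dot e c s N \o U.
  pose V' N : {linear H -> H} := U' \o rotation dot e c (- s) N.
  have cV N : contractive (V N).
    by move=> x; rewrite /V /= (rotation_norm dot_norm oe _ _ cs); exact: cU.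
  have cV' N : contractive (V' N).
    by move=> x; rewrite /V' /= (le_trans (cU' _))// (rotation_norm dot_norm oe _ _ csN).
  have UU' x y : dot (U x) y = dot x (U' y).
    by rewrite unitary_adjoint// adjU.
  have VW N : W (F (V' N) (V N)).
    have [] := @unitary_intro _ _ _ dot_norm (V N) (V' N).
    - by move=> x y; rewrite /V /V' /= rotation_adj UU'.
    - move=> x; rewrite /V /V' /=; have := rotationK oe N (U x) csN.
      by rewrite opprK => ->; rewrite UK.
    - by move=> x; rewrite /V /V' /= U'K rotationK.
    move=> uV adjV; exists (V N) => //; rewrite adjV.
    by apply/esym/(trace_eq be); exact: trF.
  have wV : wcvg dot V c%:C U.
    by move=> B M BM x y; exact: (@rotation_wcvg _ _ _ dot_norm _ oe c s B M).
  have wV' : wcvg dot V' c%:C U'.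
    move=> B M [M0 BM] x y; rewrite /V' /=.
    apply: (@rotation_wcvg _ _ _ dot_norm _ oe c (- s) (B \o U') M) => //.
    by split=> // z /=; rewrite (le_trans (BM _))// ler_wpM2l.
  have c1 : `|c%:C| <= 1 :> R[i].
    rewrite ger0_norm ?lecR ?sqrtr_ge0//.
    by rewrite -(@ler_pXn2r _ 2)// ?nnegrE ?sqrtr_ge0// c2 expr1n.
  have := contF _ _ _ _ _ c1 cV' cV cU' cU wV' wV.
  rewrite -expr2 -rmorphXn /= c2 => FV B /FV[N _ /(_ N (leqnn _)) BN].
  by exists (F (V' N) (V N)); split.
(* Scaling by t is 1-Lipschitz, so the property passes to the closure. *)
have star (z : R[i]^o) (t : R) : closure W z -> 0 <= t <= 1 -> closure W (t%:C * z).
  move=> Wz t01 B Btz.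
  move/nbhs_ballP : Btz => [eps /= eps0 epsB].
  have e2 : 0 < eps / 2 by rewrite divr_gt0.
  have [w [Ww]] := Wz _ (nbhsx_ballx z _ e2).
  have [v [Wv]] := scaleW w t Ww t01 _ (nbhsx_ballx (t%:C * w : R[i]^o) _ e2).
  rewrite -!ball_normE /= => wv zw; exists v; split=> //; apply: epsB.
  rewrite -ball_normE /=.
  have -> : (t%:C * z : R[i]^o) - v = t%:C * (z - w) + (t%:C * w - v) by ring.
  rewrite (splitr eps) (le_lt_trans (ler_normD _ _))// ltr_leD// ?(ltW wv)//.
  case/andP: t01 => t0 t1; rewrite normrM (le_lt_trans _ zw)//.
  by rewrite ler_piMl// ger0_norm lecR.
split; last by move=> z t Wz t01; rewrite mulr0 add0r; exact: star.
have [id1 adj1] := @unitary_intro _ _ _ dot_norm idfun idfun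
  (fun x y => erefl) (fun=> erefl) (fun=> erefl).
pose z := trace dot (C \o adjoint dot idfun \o T \o idfun).
have Wz : closure W z by apply: subset_closure; exists idfun.
by have := star z 0 Wz; rewrite lexx ler01 => /(_ isT); rewrite mul0r.
Qed.
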